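(* Let $f:\mathbb{R}^d\to\mathbb{R}$ be $\mu$-strongly convex and $L$-smooth (i.e. $\nabla f$ is $L$-Lipschitz), with minimum value $f_\ast$. Let $\theta_0\in\mathbb{R}^d$ be fixed and define iterates $\theta_{t+1}=\theta_t-\alpha\,(\gamma_t\odot g_t)$ with $\alpha=1/L$, where $g_t$ is a random vector satisfying, conditionally on the history $\theta_0,\dots,\theta_t$, $\mathbf{E}[g_t\mid\theta_t]=\nabla f(\theta_t)$ and $\mathbf{var}[g_{t,i}\mid\theta_t]=\sigma_{t,i}^2<\infty$, and where the (idealized) variance adaptation factors are $$\gamma_{t,i}=\frac{\nabla f(\theta_t)_i^2}{\nabla f(\theta_t)_i^2+\sigma_{t,i}^2}$$ (with $\gamma_{t,i}:=0$ if the denominator vanishes). Assume there are constants $c_v,M_v>0$ such that for all $t$, $\sum_{i=1}^d\sigma_{t,i}^2\le c_v\|\nabla f(\theta_t)\|^2+M_v$. Then $\mathbf{E}[f(\theta_t)-f_\ast]\in\mathcal{O}(1/t)$ as $t\to\infty$.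
   Context: $\odot$ denotes element-wise multiplication; $\|\cdot\|$ is the Euclidean norm; $x_i$ denotes the $i$-th coordinate of a vector $x$. *)

(* Defs.v *)
From HB Require Import structures.
From mathcomp Require Import all_boot all_order all_algebra.
From mathcomp Require Import all_classical all_reals all_analysis.
Set Implicit Arguments. Unset Strict Implicit. Unset Printing Implicit Defensive.
Import Order.TTheory GRing.Theory Num.Theory.
Import numFieldNormedType.Exports.
Local Open Scope classical_set_scope.
Local Open Scope ring_scope.

Section Defs.
Variable R : realType.
Variable d : nat.

(* Euclidean norm on R^d (the library norm on 'rV is the max norm) *)
Definition enorm (v : 'rV[R]_d) : R := Num.sqrt (\sum_i (v 0 i) ^+ 2).

Definition grad (f : 'rV[R]_d -> R) (x : 'rV[R]_d) : 'rV[R]_d :=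
  \row_i ('D_(delta_mx 0 i) f x).

Definition strongly_convex (mu : R) (f : 'rV[R]_d -> R) : Prop :=
  forall (x y : 'rV[R]_d) (l : R), 0 <= l <= 1 ->
    f (l *: x + (1 - l) *: y) <=
      l * f x + (1 - l) * f y - mu / 2 * l * (1 - l) * (enorm (x - y)) ^+ 2.

Definition L_smooth (L : R) (f : 'rV[R]_d -> R) : Prop :=
  (forall x, differentiable f x) /\
  forall x y, enorm (grad f x - grad f y) <= L * enorm (x - y).

Definition gamma_factor (a s : R) : R :=
  if a ^+ 2 + s == 0 then 0 else a ^+ 2 / (a ^+ 2 + s).

Fixpoint iterates {T : Type} (f : 'rV[R]_d -> R) (alpha : R)
    (theta0 : 'rV[R]_d) (g : nat -> T -> 'rV[R]_d)
    (sigma2 : nat -> T -> 'I_d -> R) (t : nat) : T -> 'rV[R]_d :=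
  match t with
  | 0 => fun _ => theta0
  | t'.+1 => fun w =>
      let th := iterates f alpha theta0 g sigma2 t' w in
      th - alpha *: \row_i (gamma_factor (grad f th 0 i) (sigma2 t' w i)
                            * g t' w 0 i)
  end.

Definition history {T : Type} (theta : nat -> T -> 'rV[R]_d) (t : nat)
  : set (set T) :=
  <<s [set A | exists (s : nat) (i : 'I_d) (B : set R),
         (s <= t)%N /\ measurable B /\ A = (fun w => theta s w 0 i) @^-1` B] >>.

End Defs.

(* Main.v *)
(* Writing g = a + e with a = grad f (theta), the factor gamma = a^2 / (a^2 + s)
   turns the quadratic upper bound of an L-smooth function into
     D' <= D - (1/2L) sum_i gamma_i a_i^2 + (1/L) sum_i noise_i,
   where D = f(theta) - f_* and noise_i has conditional mean zero.  Since
   gamma b = a^2 for b = a^2 + s, expanding b (gamma - l)^2 >= 0 gives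
   gamma a^2 >= 2 l a^2 - l^2 b for every l, which is linear in a^2 and s: the
   variance bound and the Polyak-Lojasiewicz inequality then yield, without
   Jensen's inequality and for every small constant l,
     E D' <= (1 - mu l / 2L) E D + l^2 Mv / 2L,
   and choosing l of order 1/t at time t gives the rate 1/t. *)
Require Import Defs.
From HB Require Import structures.
From mathcomp Require Import all_boot all_order all_algebra.
From mathcomp Require Import all_classical all_reals all_analysis.
From mathcomp Require Import finmap measurable_realfun ring lra.
Set Implicit Arguments. Unset Strict Implicit. Unset Printing Implicit Defensive.
Import Order.TTheory GRing.Theory Num.Theory.
Import numFieldNormedType.Exports.
Local Open Scope classical_set_scope.
Local Open Scope ring_scope.
Import HBNNSimple.

(** * Quadratic bounds for smooth functions, and the gap compared with the gradient *)

(** The mean value theorem is applied to [phi] minus its quadratic model, whose derivative is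
    nonpositive inside the interval. Only a one-sided bound on [dphi] is asked, so that the lemma
    also applies to [- phi]. *)
Lemma le_quadratic_of_derive (R : realType) (phi dphi : R -> R) (M : R) :
  (forall s : R, is_derive s (1 : R) phi (dphi s)) ->
  (forall s : R, 0 < s < 1 -> dphi s - dphi 0 <= M * s) ->
  phi 1 <= phi 0 + dphi 0 + M / 2.
Proof.
move=> dphiE dphi_le.
pose psi := fun s => phi s - dphi 0 * s - M / 2 * s ^+ 2.
have dpsi (s : R) : is_derive s (1 : R) psi (dphi s - dphi 0 - M * s).
  rewrite /psi; apply: is_derive_eq.
  by rewrite /GRing.scale /=; field.
have cpsi : {within `[0, 1], continuous psi}.
  by apply: derivable_within_continuous => s _; exact: ex_derive.
have [c] := MVT ltr01 (fun s _ => dpsi s) cpsi.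
rewrite in_itv /= => /dphi_le le_c.
rewrite /psi subr0 !mulr1 expr1n expr0n /= !mulr0 !subr0 mulr1.
by move: le_c; lra.
Qed.

Lemma derive_grad (R : realType) (d : nat) (f : 'rV[R]_d -> R) (x v : 'rV[R]_d) :
  differentiable f x -> 'D_v f x = \sum_i grad f x 0 i * v 0 i.
Proof.
move=> df; rewrite deriveE // [in LHS](row_sum_delta v) linear_sum.
apply: eq_bigr => i _; rewrite linearZ /= mxE deriveE // /GRing.scale /=.
by rewrite mulrC.
Qed.

Lemma is_derive_line (R : realType) (d : nat) (f : 'rV[R]_d -> R)
    (x v : 'rV[R]_d) (s : R) : (forall y, differentiable f y) ->
  is_derive s (1 : R) (fun u : R => f (x + u *: v)) (\sum_i grad f (x + s *: v) 0 i * v 0 i).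
Proof.
move=> df; rewrite -derive_grad //.
have E : (fun h => h^-1 *: (f (h *: v + (x + s *: v)) - f (x + s *: v))) =
  (fun h => h^-1 *: (((fun u : R => f (x + u *: v)) \o shift s) (h *: (1 : R)) - f (x + s *: v))).
  apply/funext => h /=; congr (_ *: (f _ - _)).
  by rewrite [h *: 1]mulr1 scalerDl addrCA.
apply: DeriveDef; last by rewrite /derive E.
by have := @diff_derivable _ _ _ f (x + s *: v) v (df _); rewrite /derivable /= E.
Qed.

Lemma enormE (R : realType) (d : nat) (v : 'rV[R]_d) :
  enorm v ^+ 2 = \sum_i v 0 i ^+ 2.
Proof. by rewrite sqr_sqrtr // sumr_ge0 // => i _; rewrite sqr_ge0. Qed.

(** Young's inequality, from a sum of squares; with a suitable weight [c] it does the work of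
    Cauchy-Schwarz. *)
Lemma dot_le (R : realType) (d : nat) (u v : 'rV[R]_d) (c : R) : 0 < c ->
  2 * (\sum_i u 0 i * v 0 i) <= c * enorm v ^+ 2 + c^-1 * enorm u ^+ 2.
Proof.
move=> c0; rewrite !enormE !mulr_sumr -big_split /=; apply: ler_sum => i _.
rewrite -subr_ge0; set a := u 0 i; set b := v 0 i.
have -> : c * b ^+ 2 + c^-1 * a ^+ 2 - 2 * (a * b) = c^-1 * (c * b - a) ^+ 2.
  by field; rewrite gt_eqF.
by rewrite mulr_ge0 ?invr_ge0 ?sqr_ge0 ?ltW.
Qed.

Lemma enormZ_sqr (R : realType) (d : nat) (v : 'rV[R]_d) (s : R) :
  enorm (s *: v) ^+ 2 = s ^+ 2 * enorm v ^+ 2.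
Proof.
by rewrite !enormE mulr_sumr; apply: eq_bigr => i _; rewrite mxE exprMn.
Qed.

Lemma enorm_ge0 (R : realType) (d : nat) (v : 'rV[R]_d) : 0 <= enorm v.
Proof. exact: sqrtr_ge0. Qed.

(** Young's inequality with weight [L * s] makes its two terms equal in the worst case allowed by
    the Lipschitz bound. The sign [e] is [1] for the upper and [-1] for the lower quadratic
    bound. *)
Lemma L_smooth_dot_le (R : realType) (d : nat) (f : 'rV[R]_d -> R) (L : R)
    (x v : 'rV[R]_d) (s e : R) : 0 < L -> L_smooth L f -> 0 < s -> e ^+ 2 = 1 ->
  e * \sum_i grad f (x + s *: v) 0 i * v 0 i - e * \sum_i grad f x 0 i * v 0 i
    <= L * enorm v ^+ 2 * s.
Proof.
move=> L0 [_ fL] s0 e1.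
have /(_ (e *: (grad f (x + s *: v) - grad f x)) v (L * s)) := @dot_le R d.
have -> : \sum_i (e *: (grad f (x + s *: v) - grad f x)) 0 i * v 0 i =
  e * \sum_i grad f (x + s *: v) 0 i * v 0 i - e * \sum_i grad f x 0 i * v 0 i.
  by rewrite !mulr_sumr -sumrB; apply: eq_bigr => i _; rewrite !mxE; lra.
have Ls : 0 < L * s by rewrite mulr_gt0.
move=> /(_ Ls); rewrite enormZ_sqr e1 mul1r.
have /(_ (x + s *: v) x) := fL; rewrite addrAC subrr add0r => le1.
have : enorm (grad f (x + s *: v) - grad f x) ^+ 2 <= (L * s) ^+ 2 * enorm v ^+ 2.
  rewrite exprMn -mulrA -enormZ_sqr -exprMn ler_sqr ?nnegrE ?enorm_ge0 //.
  by rewrite mulr_ge0 ?enorm_ge0 ?ltW.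
move=> le2 le3; have : (L * s)^-1 * enorm (grad f (x + s *: v) - grad f x) ^+ 2
    <= L * s * enorm v ^+ 2.
  by rewrite mulrC ler_pdivrMr //; move: le2; rewrite expr2; lra.
by move: le3; lra.
Qed.

Lemma L_smooth_upper (R : realType) (d : nat) (f : 'rV[R]_d -> R) (L : R)
    (x v : 'rV[R]_d) : 0 < L -> L_smooth L f ->
  f (x + v) <= f x + \sum_i grad f x 0 i * v 0 i + L / 2 * enorm v ^+ 2.
Proof.
move=> L0 fL; have [df _] := fL.
have := @le_quadratic_of_derive R (fun s => f (x + s *: v))
  (fun s => \sum_i grad f (x + s *: v) 0 i * v 0 i) (L * enorm v ^+ 2).
rewrite !scale1r !scale0r !addr0 [_ / 2]mulrAC; apply.
  by move=> s; exact: is_derive_line.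
move=> s /andP[s0 _]; have := L_smooth_dot_le (e := 1) x v L0 fL s0.
by rewrite !mul1r expr1n; apply.
Qed.

Lemma L_smooth_lower (R : realType) (d : nat) (f : 'rV[R]_d -> R) (L : R)
    (x v : 'rV[R]_d) : 0 < L -> L_smooth L f ->
  f x + \sum_i grad f x 0 i * v 0 i - L / 2 * enorm v ^+ 2 <= f (x + v).
Proof.
move=> L0 fL; have [df _] := fL.
have := @le_quadratic_of_derive R (fun s => - f (x + s *: v))
  (fun s => - \sum_i grad f (x + s *: v) 0 i * v 0 i) (L * enorm v ^+ 2).
rewrite !scale1r !scale0r !addr0 [_ / 2]mulrAC => H.
suff : - f (x + v) <= - f x - \sum_i grad f x 0 i * v 0 i + L / 2 * enorm v ^+ 2.
  by lra.
apply: H => s; first by apply: is_deriveN; exact: is_derive_line.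
move=> /andP[s0 _]; have := L_smooth_dot_le (e := -1) x v L0 fL s0.
by rewrite !mulN1r sqrrN expr1n; apply.
Qed.

(** A gradient step of length [1 / L] lowers [f] by at least [G / (2 * L)] and cannot go below
    [fstar]. This later makes the squared gradient integrable as soon as the gap is. *)
Lemma grad_le_gap (R : realType) (d : nat) (f : 'rV[R]_d -> R) (L fstar : R)
    (x : 'rV[R]_d) : 0 < L -> L_smooth L f -> (forall y, fstar <= f y) ->
  enorm (grad f x) ^+ 2 <= 2 * L * (f x - fstar).
Proof.
move=> L0 fL fmin; have := L_smooth_upper x (- L^-1 *: grad f x) L0 fL.
move: (fmin (x + - L^-1 *: grad f x)); rewrite enormZ_sqr.
have -> : \sum_i grad f x 0 i * (- L^-1 *: grad f x) 0 i =
    - L^-1 * enorm (grad f x) ^+ 2.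
  by rewrite enormE mulr_sumr; apply: eq_bigr => i _; rewrite !mxE; ring.
set G := enorm _ ^+ 2 => h1 h2.
have {h1 h2} : fstar <= f x + - L^-1 * G + L / 2 * ((- L^-1) ^+ 2 * G).
  exact: le_trans h2.
have -> : f x + - L^-1 * G + L / 2 * ((- L^-1) ^+ 2 * G) = f x - (2 * L)^-1 * G.
  by field; rewrite gt_eqF.
rewrite lerBrDl -lerBrDr mulrC ler_pdivrMr; last by lra.
by rewrite mulrC.
Qed.

(* Comparing the lower quadratic bound with strong convexity on a segment of
   the fixed length [l = mu / (2 (L + mu))] loses a factor 2 with respect to the
   usual constant but avoids the limit [l -> 0]. *)
Lemma gap_le_grad (R : realType) (d : nat) (f : 'rV[R]_d -> R) (mu L fstar : R)
    (x : 'rV[R]_d) : 0 < mu -> 0 < L -> strongly_convex mu f -> L_smooth L f ->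
  (exists y, f y = fstar) ->
  mu * (f x - fstar) <= enorm (grad f x) ^+ 2.
Proof.
move=> mu0 L0 fmu fL [y fy].
pose l := mu / (2 * (L + mu)).
have l0 : 0 < l by rewrite divr_gt0 //; lra.
have l1 : l <= 1 by rewrite ler_pdivrMr; lra.
have lE : L * l + mu * l = mu / 2 by rewrite /l; field; rewrite gt_eqF; lra.
have := fmu y x l; rewrite l1 ltW // => /(_ isT).
have -> : l *: y + (1 - l) *: x = x + l *: (y - x).
  by rewrite scalerBl scale1r scalerBr addrCA.
have := L_smooth_lower x (l *: (y - x)) L0 fL; rewrite enormZ_sqr.
have -> : \sum_i grad f x 0 i * (l *: (y - x)) 0 i =
    l * \sum_i grad f x 0 i * (y - x) 0 i.
  by rewrite mulr_sumr; apply: eq_bigr => i _; rewrite [(l *: (y - x))%R 0 i]mxE mulrCA.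
(* The choice of [l] leaves the curvature term [mu / 4 * E]; the weight [mu / 2] is the one for
   which Young's inequality cancels it exactly. *)
have := @dot_le R d (grad f x) (- (y - x)) (mu / 2).
have -> : \sum_i grad f x 0 i * (- (y - x)) 0 i =
    - \sum_i grad f x 0 i * (y - x) 0 i.
  by rewrite -sumrN; apply: eq_bigr => i _; rewrite [(- (y - x))%R 0 i]mxE mulrN.
rewrite -(scaleN1r (y - x)) enormZ_sqr sqrrN expr1n mul1r fy.
set S := \sum_i _; set E := enorm _ ^+ 2; set G := enorm _ ^+ 2.
move=> dotS lower upper.
have {}dotS : - 2 * S <= mu / 2 * E + 2 / mu * G.
  have h : 0 < mu / 2 by lra.
  by move: (dotS h); rewrite invf_div; lra.
have : l * (S - L / 2 * l * E) <= l * (fstar - f x - mu / 2 * (1 - l) * E).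
  by move: (le_trans lower upper); rewrite expr2; lra.
rewrite ler_pM2l // => h.
have h2 : S <= fstar - f x - mu / 4 * E.
  have : L / 2 * l * E + mu / 2 * l * E = mu / 4 * E.
    by rewrite -mulrDl; congr (_ * _); move: lE; lra.
  by move: h; lra.
have h3 : f x - fstar <= G / mu.
  by rewrite [G / mu]mulrC; move: dotS; rewrite -[2 / mu * G]mulrA; lra.
by move: h3; rewrite ler_pdivlMr // mulrC.
Qed.

(** * Measurability of continuous functions of a random vector *)

Lemma rV_ballP (R : realType) (d : nat) (x y : 'rV[R]_d) (e : R) : 0 < e ->
  ball x e y <-> forall i, `|x 0 i - y 0 i| < e.
Proof.
move=> e0; split; first by move=> [_ xy] i; exact: (xy 0 i).
by move=> xy; split=> // i j; rewrite (ord1 i); exact: xy.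
Qed.

(** The preimage of an open interval is an open set, hence a countable union of boxes with rational
    centre and radius [1 / (n + 1)]; each box is a finite intersection of coordinate conditions. As
    [T] is arbitrary, the lemma also applies to the history sigma-algebra. *)
Lemma measurable_continuous_rV (R : realType) (d : nat) (d0 : measure_display)
    (T : measurableType d0) (theta : T -> 'rV[R]_d) (h : 'rV[R]_d -> R) :
  continuous h -> (forall i, measurable_fun setT (fun w => theta w 0 i)) ->
  measurable_fun setT (fun w => h (theta w)).
Proof.
move=> ch mtheta.
apply: (measurability _ (RGenOpens.measurableE R)) => _ [B [a [b ->]] <-].
rewrite setTI; set U := h @^-1` `]a, b[%classic.
have oU : open U by apply: open_comp => //; exact: itv_open.
pose q (z : 'rV[rat]_d) : 'rV[R]_d := map_mx ratr z.
pose F (p : 'rV[rat]_d * nat) : set T :=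
  [set w | ball (q p.1) p.2.+1%:R^-1 `<=` U /\ ball (q p.1) p.2.+1%:R^-1 (theta w)].
have -> : (fun w => h (theta w)) @^-1` `]a, b[%classic = \bigcup_p F p.
  apply/seteqP; split=> w /=; last by move=> [p _ [sub /sub]].
  move=> Uw; have : nbhs (theta w) U by apply: open_nbhs_nbhs.
  move=> /nbhs_ballP[e /= e0 eU].
  (* A radius below [e / 2] keeps a box that contains [theta w] inside the ball of radius [e] around
     [theta w]. *)
  have [n] : exists n : nat, n.+1%:R^-1 < e / 2.
    have e2 : 0 < e / 2 by rewrite divr_gt0.
    by have [n _ /(_ n (leqnn n))] := near_infty_natSinv_lt (PosNum e2); exists n.
  move=> ne; have n0 : 0 < n.+1%:R^-1 :> R by rewrite invr_gt0.
  have : forall i, exists z : rat, `|ratr z - theta w 0 i| < n.+1%:R^-1.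
    move=> i; have : theta w 0 i < theta w 0 i + n.+1%:R^-1 by rewrite ltrDl.
    move=> /rat_in_itvoo[z]; rewrite in_itv /= => /andP[z1 z2]; exists z.
    by rewrite gtr0_norm ?subr_gt0 // ltrBlDl.
  move=> /choice[z zP]; exists (\row_i z i, n) => //; split=> /=.
    move=> y /rV_ballP-/(_ n0) yz; apply: eU; apply/rV_ballP => // i.
    rewrite (splitr e) (le_lt_trans (ler_distD (ratr (z i)) _ _)) //.
    rewrite ltrD // (lt_trans _ ne) // ?(distrC (theta w 0 i)) //.
    by have := yz i; rewrite !mxE.
  by apply/rV_ballP => // i; rewrite !mxE.
apply: countable_bigcupT_measurable => [|[z n]]; first exact: countableP.
have [sub|nsub] := pselect (ball (q z) n.+1%:R^-1 `<=` U); last first.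
  suff -> : F (z, n) = set0 by exact: measurable0.
  by apply/seteqP; split=> // w [].
have n0 : 0 < n.+1%:R^-1 :> R by rewrite invr_gt0.
have -> : F (z, n) = \bigcap_(i in [set: 'I_d])
    ((fun w => theta w 0 i) @^-1` ball (q z 0 i) n.+1%:R^-1).
  apply/seteqP; split=> w.
    by move=> [_ /rV_ballP-/(_ n0) zw] i _; exact: zw.
  by move=> zw; split=> //; apply/rV_ballP => // i; exact: zw.
apply: fin_bigcap_measurable => // i _; rewrite -[X in measurable X]setTI.
by apply: mtheta => //; exact: measurable_ball.
Qed.

Lemma L_smooth_continuous_grad (R : realType) (d : nat) (f : 'rV[R]_d -> R)
    (L : R) (i : 'I_d) : 0 < L -> L_smooth L f -> continuous (fun x => grad f x 0 i).
Proof.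
move=> L0 [_ fL] x.
apply/(@cvgrPdist_lt _ R^o _ (nbhs x) _ (fun y => grad f y 0 i)) => e e0.
have d0 : 0 < d%:R + 1 :> R by rewrite ltr_wpDl.
(* Coordinate differences below [c] give a Euclidean distance below [(d + 1) * c = e / L]; the
   factor [d + 1] stays positive for [d = 0]. *)
pose c := e / (L * (d%:R + 1)).
have c0 : 0 < c by rewrite divr_gt0 // mulr_gt0.
apply/nbhs_ballP; exists c => // y /= /rV_ballP-/(_ c0) xy.
have gi : `|grad f x 0 i - grad f y 0 i| <= enorm (grad f x - grad f y).
  rewrite -[leLHS]sqrtr_sqr ler_wsqrtr // (bigD1 i) //= !mxE lerDl.
  by rewrite sumr_ge0 // => j _; rewrite sqr_ge0.
apply: le_lt_trans gi _; apply: le_lt_trans (fL _ _) _.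
have : enorm (x - y) ^+ 2 < ((d%:R + 1) * c) ^+ 2.
  rewrite enormE (@le_lt_trans _ _ (\sum_(j < d) c ^+ 2)) //.
    by apply: ler_sum => j _; rewrite -real_normK ?num_real // ler_sqr ?nnegrE //;
      rewrite ?ltW // !mxE.
  rewrite sumr_const card_ord -(mulr_natl (c ^+ 2)) (exprMn _ _ c) ltr_pM2r ?exprn_gt0 //.
  by rewrite sqrrD1 mulr2n; have : 0 <= d%:R :> R by []; nra.
rewrite ltr_sqr ?nnegrE ?enorm_ge0 //; last by rewrite mulr_ge0 ?ltW.
rewrite -(ltr_pM2l L0) => /lt_le_trans; apply.
by rewrite mulrA mulrC divfK // gt_eqF // mulr_gt0.
Qed.

(** * Pulling a measurable factor out of a conditional mean equal to zero *)

(** The level sets of [phi] lie in the small sigma-algebra, so the integral splits into finitely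
    many multiples of integrals of [X] that vanish. *)
Lemma integral_nnsfun_mul_eq0 (R : realType) (d0 : measure_display)
    (T : measurableType d0) (P : probability T R) (G : set (set T))
    (X : T -> R) (phi : {nnsfun (g_sigma_algebraType G) >-> R}) :
  <<s G >> `<=` measurable -> P.-integrable setT (fun w => (X w)%:E) ->
  (forall A, <<s G >> A -> (\int[P]_(w in A) (X w)%:E = 0)%E) ->
  (\int[P]_w (phi w * X w)%:E = 0)%E.
Proof.
move=> sG iX X0.
pose s := fset_set (range phi); pose A (y : R) : set T := phi @^-1` [set y].
have mA y : <<s G >> (A y).
  by rewrite -[X in <<s _ >> X]setTI; apply: (measurable_funPT phi).
have phiE (w : T) : (phi w * X w)%:E =
    (\sum_(y <- s) y%:E * ((fun w => (X w)%:E) \_ (A y)) w)%E.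
  rewrite (fimfunE phi) fsbig_finite // mulr_suml -sumEFin.
  apply: eq_bigr => y _; rewrite -mulrA EFinM; congr (_ * _)%E.
  by rewrite patchE indicE; case: ifPn => _; rewrite ?mul1r ?mul0r.
have iXA y : P.-integrable setT ((fun w => (X w)%:E) \_ (A y)).
  rewrite -integrable_mkcond; last exact: sG.
  by apply: integrableS iX => //; exact: sG.
rewrite (@eq_integral _ T R P setT _ _ (fun w _ => phiE w)) integral_sum //.
  by apply: big1 => y _; rewrite integralZl // -integral_mkcond X0 ?mule0.
by move=> y; exact: integrableZl.
Qed.

(** Simple functions increase to [K], and their products with [X] are dominated by the integrable
    [|K * X|]. *)
Lemma ge0_integral_mul_eq0 (R : realType) (d0 : measure_display)
    (T : measurableType d0) (P : probability T R) (G : set (set T))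
    (X K : T -> R) :
  <<s G >> `<=` measurable -> P.-integrable setT (fun w => (X w)%:E) ->
  (forall A, <<s G >> A -> (\int[P]_(w in A) (X w)%:E = 0)%E) ->
  measurable_fun setT (K : g_sigma_algebraType G -> R) -> (forall w, 0 <= K w) ->
  P.-integrable setT (fun w => (K w * X w)%:E) ->
  (\int[P]_w (K w * X w)%:E = 0)%E.
Proof.
move=> sG iX X0 mK K0 iKX.
have mK' : measurable_fun setT (EFin \o K : g_sigma_algebraType G -> \bar R).
  exact/measurable_EFinP.
pose phi := nnsfun_approx measurableT mK'.
have mX := measurable_int _ iX.
have mphi n : measurable_fun setT (phi n : T -> R).
  by move=> _ B mB; apply: sG; exact: (measurable_funP (phi n)).
have [|||||_ _ h] := @dominated_convergence _ _ _ P setT measurableT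
  (fun n w => (phi n w * X w)%:E) (fun w => (K w * X w)%:E)
  (fun w => `|(K w * X w)%:E|%E).
- move=> n; apply/measurable_EFinP; apply: measurable_funM => //.
  exact/measurable_EFinP.
- exact: measurable_int iKX.
- apply: aeW => w _; apply: cvg_EFin; first by near=> n.
  rewrite /comp /=; apply: cvgMl.
  have := @cvg_nnsfun_approx _ (g_sigma_algebraType G) R setT measurableT _ mK'
    (fun x _ => K0 x) w I.
  by move=> /fine_cvgP[].
- exact: integrable_abse.
- apply: aeW => w n _; rewrite lee_fin !normrM ler_wpM2r //.
  rewrite (ger0_norm (K0 w)) ger0_norm ?fun_ge0 //.
  rewrite /phi nnsfun_approxE -lee_fin.
  exact: (@le_approx _ (g_sigma_algebraType G) R setT (EFin \o K) n w (fun x _ => K0 x) I).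
- move: h; under eq_fun do rewrite integral_nnsfun_mul_eq0 //.
  by move=> h; apply/esym; apply: (cvg_unique _ (cvg_cst _) h).
Unshelve. all: by end_near. Qed.

Lemma integral_mul_eq0 (R : realType) (d0 : measure_display)
    (T : measurableType d0) (P : probability T R) (G : set (set T))
    (X K : T -> R) :
  <<s G >> `<=` measurable -> P.-integrable setT (fun w => (X w)%:E) ->
  (forall A, <<s G >> A -> (\int[P]_(w in A) (X w)%:E = 0)%E) ->
  measurable_fun setT (K : g_sigma_algebraType G -> R) ->
  P.-integrable setT (fun w => (K w * X w)%:E) ->
  (\int[P]_w (K w * X w)%:E = 0)%E.
Proof.
move=> sG iX X0 mK iKX.
(* The positive part of [K] is the case [e = 1], the negative part the case [e = -1]. *)
have part (e : R) : e ^+ 2 = 1 ->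
    P.-integrable setT (fun w => (Num.max (e * K w) 0 * X w)%:E) /\
    (\int[P]_w (Num.max (e * K w) 0 * X w)%:E = 0)%E.
  move=> e1.
  have mM : measurable_fun setT
      ((fun w => Num.max (e * K w) 0) : g_sigma_algebraType G -> R).
    by apply: measurable_maxr => //; apply: measurable_funM.
  have iM : P.-integrable setT (fun w => (Num.max (e * K w) 0 * X w)%:E).
    apply: le_integrable iKX => //.
      apply/measurable_EFinP; apply: measurable_funM.
        by move=> _ B mB; apply: sG; exact: mM.
      by apply/measurable_EFinP; exact: measurable_int iX.
    move=> w _; rewrite lee_fin !normrM ler_wpM2r //.
    have -> : `|K w| = `|e * K w|.
      by rewrite normrM; have /eqP := e1; rewrite sqrf_eq1 => /orP[]/eqP->;
        rewrite ?normrN normr1 mul1r.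
    by case: (leP (e * K w) 0); rewrite ?normr0.
  by split=> //; apply: (ge0_integral_mul_eq0 (G := G)) => // w; rewrite le_max lexx orbT.
have [|i1 z1] := part 1; first by rewrite expr1n.
have [|i2 z2] := part (-1); first by rewrite sqrrN expr1n.
transitivity (\int[P]_w ((Num.max (1 * K w) 0 * X w)%:E
    - (Num.max (-1 * K w) 0 * X w)%:E))%E.
  apply: eq_integral => w _; rewrite -EFinB -mulrBl mul1r mulN1r.
  congr ((_ * _)%:E); case: (leP (K w) 0) => Kw; case: (leP (- K w) 0); lra.
by rewrite integralB_EFin // z1 z2 sube0.
Qed.

(** * The adaptation factor and the pathwise one-step inequality *)

Lemma gamma_factorE (R : realType) (a s : R) :
  gamma_factor a s = a ^+ 2 / (a ^+ 2 + s).
Proof. by rewrite /gamma_factor; case: eqP => // ->; rewrite invr0 mulr0. Qed.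

Lemma gamma_factor_itv (R : realType) (a s : R) : 0 <= s ->
  0 <= gamma_factor a s <= 1.
Proof.
move=> s0; have a0 := sqr_ge0 a; rewrite gamma_factorE divr_ge0 ?addr_ge0 //=.
have [->|den0] := eqVneq (a ^+ 2 + s) 0; first by rewrite invr0 mulr0.
by rewrite ler_pdivrMr ?mul1r ?lerDl // lt_def den0 addr_ge0.
Qed.

(** If the denominator vanishes, [s >= 0] forces [a = 0], so the default value [0] of the factor is
    consistent. *)
Lemma gamma_factorM (R : realType) (a s : R) : 0 <= s ->
  gamma_factor a s * (a ^+ 2 + s) = a ^+ 2.
Proof.
move=> s0; rewrite gamma_factorE; have [den0|den0] := eqVneq (a ^+ 2 + s) 0.
  by rewrite den0 mulr0; move: den0 (sqr_ge0 a); lra.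
by rewrite divfK.
Qed.

(* What remains of [- gamma a u + (gamma u)^2 / 2] once its conditional mean
   [- gamma a^2 / 2] is removed; [u] has conditional mean [a] and variance [s]. *)
Definition noise (R : realType) (a s u : R) : R :=
  (gamma_factor a s ^+ 2 - gamma_factor a s) * a * (u - a)
  + gamma_factor a s ^+ 2 / 2 * ((u - a) ^+ 2 - s).

(** The right side minus the left side equals [b * (gamma - l) ^ 2 / 2] with [b = a ^ 2 + s]. *)
Lemma coordinate_step (R : realType) (a s u l : R) : 0 <= s ->
  - (a * (gamma_factor a s * u)) + (gamma_factor a s * u) ^+ 2 / 2 <=
  (l ^+ 2 * (a ^+ 2 + s) - 2 * l * a ^+ 2) / 2 + noise a s u.
Proof.
move=> s0; have := gamma_factorM a s0; rewrite /noise.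
set c := gamma_factor a s => cE.
have b0 : 0 <= (a ^+ 2 + s) * (c - l) ^+ 2 by rewrite mulr_ge0 ?addr_ge0 ?sqr_ge0.
have {}b0 : 0 <= c * a ^+ 2 - 2 * l * a ^+ 2 + l ^+ 2 * (a ^+ 2 + s).
  have -> : c * a ^+ 2 - 2 * l * a ^+ 2 + l ^+ 2 * (a ^+ 2 + s) =
      (c - 2 * l) * (c * (a ^+ 2 + s)) + l ^+ 2 * (a ^+ 2 + s) by rewrite cE; ring.
  by move: b0; congr (_ <= _); ring.
have c2 : c ^+ 2 * (a ^+ 2 + s) = c * a ^+ 2 by rewrite expr2 -mulrA cE.
rewrite -subr_ge0.
have -> : (l ^+ 2 * (a ^+ 2 + s) - 2 * l * a ^+ 2) / 2 +
  ((c ^+ 2 - c) * a * (u - a) + c ^+ 2 / 2 * ((u - a) ^+ 2 - s)) -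
  (- (a * (c * u)) + (c * u) ^+ 2 / 2) =
  (c * a ^+ 2 - 2 * l * a ^+ 2 + l ^+ 2 * (a ^+ 2 + s)) / 2
  + (c * a ^+ 2 - c ^+ 2 * (a ^+ 2 + s)) / 2 by field.
by rewrite c2 subrr mul0r addr0 divr_ge0.
Qed.

(** The successor case of [iterates] with step [1 / L], as a deterministic map of the current point,
    gradient sample and variances. *)
Definition adapted_step (R : realType) (d : nat) (f : 'rV[R]_d -> R) (L : R)
    (x u : 'rV[R]_d) (s : 'I_d -> R) : 'rV[R]_d :=
  x - L^-1 *: \row_i (gamma_factor (grad f x 0 i) (s i) * u 0 i).

Lemma adapted_step_gap (R : realType) (d : nat) (f : 'rV[R]_d -> R)
    (mu L fstar cv Mv l : R) (x u : 'rV[R]_d) (s : 'I_d -> R) :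
  0 < mu -> 0 < L -> strongly_convex mu f -> L_smooth L f ->
  (exists y, f y = fstar) -> (forall i, 0 <= s i) ->
  \sum_i s i <= cv * enorm (grad f x) ^+ 2 + Mv ->
  0 <= l -> l * (1 + cv) <= 1 ->
  f (adapted_step f L x u s) - fstar <=
  (1 - mu / (2 * L) * l) * (f x - fstar) + Mv / (2 * L) * l ^+ 2
  + L^-1 * \sum_i noise (grad f x 0 i) (s i) (u 0 i).
Proof.
move=> mu0 L0 fmu fL fmin s0 sle l0 l1.
pose v := - L^-1 *: (\row_i (gamma_factor (grad f x 0 i) (s i) * u 0 i)).
have := L_smooth_upper x v L0 fL.
have -> : x + v = adapted_step f L x u s by rewrite /adapted_step /v scaleNr.
have -> : \sum_i grad f x 0 i * v 0 i = L^-1 *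
    \sum_i - (grad f x 0 i * (gamma_factor (grad f x 0 i) (s i) * u 0 i)).
  by rewrite mulr_sumr; apply: eq_bigr => i _; rewrite !mxE; ring.
have -> : L / 2 * enorm v ^+ 2 = L^-1 *
    \sum_i (gamma_factor (grad f x 0 i) (s i) * u 0 i) ^+ 2 / 2.
  rewrite enormZ_sqr enormE -mulr_suml.
  under eq_bigr do rewrite mxE.
  by field; rewrite gt_eqF.
rewrite -addrA -mulrDr -big_split /= => h.
have : \sum_i (- (grad f x 0 i * (gamma_factor (grad f x 0 i) (s i) * u 0 i)) +
    (gamma_factor (grad f x 0 i) (s i) * u 0 i) ^+ 2 / 2) <=
    \sum_i ((l ^+ 2 * (grad f x 0 i ^+ 2 + s i) - 2 * l * grad f x 0 i ^+ 2) / 2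
      + noise (grad f x 0 i) (s i) (u 0 i)).
  by apply: ler_sum => i _; exact: coordinate_step.
rewrite -(ler_pM2l (x := L^-1)) ?invr_gt0 // => h2.
have {h h2} := le_trans h (lerD (lexx (f x)) h2).
rewrite big_split /= mulrDr -mulr_suml sumrB -!mulr_sumr big_split /= -enormE.
have := gap_le_grad x mu0 L0 fmu fL fmin.
set G := enorm _ ^+ 2; set S := \sum_i s i in sle *; set N := \sum_i noise _ _ _.
move=> pl h.
have G0 : 0 <= G by exact: sqr_ge0.
(* By [l * (1 + cv) <= 1], the quadratic term consumes at most [l * G] of the gain [2 * l * G]; the
   remaining [l * G] dominates [l * mu] times the gap. *)
have h1 : l ^+ 2 * (G + S) - 2 * l * G <= l ^+ 2 * Mv - l * (mu * (f x - fstar)).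
  have : l ^+ 2 * (G + S) <= l ^+ 2 * ((1 + cv) * G + Mv).
    by rewrite ler_wpM2l ?sqr_ge0 //; move: sle; rewrite -/G; lra.
  have : l * (l * (1 + cv) * G) <= l * (1 * G) by rewrite ler_wpM2l // ler_wpM2r.
  have : l * (mu * (f x - fstar)) <= l * G by rewrite ler_wpM2l.
  by rewrite expr2; lra.
have h3 : L^-1 * ((l ^+ 2 * (G + S) - 2 * l * G) / 2) <=
    L^-1 * ((l ^+ 2 * Mv - l * (mu * (f x - fstar))) / 2).
  by rewrite ler_wpM2l ?invr_ge0 ?(ltW L0) // ler_pM2r ?invr_gt0.
have -> : (1 - mu / (2 * L) * l) * (f x - fstar) + Mv / (2 * L) * l ^+ 2 =
    f x - fstar + L^-1 * ((l ^+ 2 * Mv - l * (mu * (f x - fstar))) / 2).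
  by field; rewrite gt_eqF.
by move: h h3; lra.
Qed.

(** * From the recursion with a free parameter to the rate [1 / t] *)

(** Taking [l = 2 / (a * (t + n))] at time [t], induction gives the bound [C / (t + n)]. *)
Lemma le_inv_of_recursion (R : realType) (e : nat -> R) (a b l0 : R) :
  0 < a -> 0 <= b -> 0 < l0 -> 0 <= e 0 ->
  (forall t l, 0 <= l -> l <= l0 -> e t.+1 <= (1 - a * l) * e t + b * l ^+ 2) ->
  exists C : R, forall t : nat, (0 < t)%N -> e t <= C / t%:R.
Proof.
move=> a0 b0 l00 e0 erec.
(* The shift [n] makes [l <= l0] already at [t = 0], and [n >= 2] keeps the factor [1 - 2 / s]
   nonnegative. *)
pose n := (Num.truncn (2 / (a * l0)) + 2)%N.
have n0 : 0 < n%:R :> R by rewrite ltr0n /n addn2.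
have nl : 2 / (a * n%:R) <= l0.
  have : 2 / (a * l0) <= n%:R.
    have := ltW (truncnS_gt (2 / (a * l0))); move=> /le_trans; apply.
    by rewrite ler_nat /n addn2.
  by rewrite !ler_pdivrMr ?mulr_gt0 //; lra.
(* The first summand starts the induction, the second absorbs the term in [b]. *)
pose C := n%:R * e 0 + 4 * b / a ^+ 2.
have bC : 4 * b / a ^+ 2 <= C by rewrite lerDr mulr_ge0 // ltW.
have C0 : 0 <= C by apply: le_trans bC; rewrite divr_ge0 ?sqr_ge0 ?mulr_ge0.
have eC t : e t <= C / (t + n)%:R.
  elim: t => [|t IH].
    by rewrite ler_pdivlMr // mulrC lerDl divr_ge0 ?sqr_ge0 ?mulr_ge0.
  set s : R := (t + n)%:R in IH.
  have s2 : 2 <= s by rewrite ler_nat /n addnA leq_addl.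
  have s0 : 0 < s by lra.
  have ns : n%:R <= s by rewrite ler_nat leq_addl.
  have -> : (t.+1 + n)%:R = s + 1 :> R by rewrite addSn -natr1.
  clearbody s.
  have as0 : 0 < a * s by rewrite mulr_gt0.
  have ge_l0 : 0 <= 2 / (a * s) by rewrite divr_ge0 // ltW.
  have le_l0 : 2 / (a * s) <= l0.
    apply: le_trans nl; rewrite ler_pM2l // lef_pV2 ?posrE ?mulr_gt0 //.
    by rewrite ler_pM2l.
  apply: le_trans (erec t _ ge_l0 le_l0) _.
  have -> : a * (2 / (a * s)) = 2 / s by field; rewrite (gt_eqF a0) (gt_eqF s0).
  have -> : b * (2 / (a * s)) ^+ 2 = 4 * b / a ^+ 2 / s ^+ 2.
    by field; rewrite (gt_eqF a0) (gt_eqF s0).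
  have h1 : (1 - 2 / s) * e t <= (1 - 2 / s) * (C / s).
    by rewrite ler_wpM2l // subr_ge0 ler_pdivrMr // mul1r.
  have h2 : 4 * b / a ^+ 2 / s ^+ 2 <= C / s ^+ 2.
    by rewrite ler_wpM2r // invr_ge0 sqr_ge0.
  apply: le_trans (lerD h1 h2) _.
  have -> : (1 - 2 / s) * (C / s) + C / s ^+ 2 = C * ((s - 1) / s ^+ 2).
    by field; rewrite gt_eqF.
  (* What remains is [(s - 1) * (s + 1) <= s ^ 2]. *)
  rewrite ler_wpM2l // ler_pdivrMr ?exprn_gt0 // mulrC ler_pdivlMr; last by lra.
  by rewrite expr2; nra.
exists C => t t0; apply: le_trans (eC t) _; rewrite ler_wpM2l //.
by rewrite lef_pV2 ?posrE ?ltr0n ?addn_gt0 ?t0 // ler_nat leq_addr.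
Qed.

(** * Integrability tools and the centering of the noise *)

Lemma integral_sub_eq0 (R : realType) (d0 : measure_display)
    (T : measurableType d0) (P : probability T R) (X Y : T -> R) (A : set T) :
  measurable A -> P.-integrable setT (fun w => (X w)%:E) ->
  P.-integrable setT (fun w => (Y w)%:E) ->
  (\int[P]_(w in A) (X w)%:E = \int[P]_(w in A) (Y w)%:E)%E ->
  (\int[P]_(w in A) (X w - Y w)%:E = 0)%E.
Proof.
move=> mA iX iY XY.
have iXA : P.-integrable A (fun w => (X w)%:E) by apply: integrableS iX.
have iYA : P.-integrable A (fun w => (Y w)%:E) by apply: integrableS iY.
under eq_integral do rewrite EFinB.
by rewrite integralB_EFin // XY subee // integrable_fin_num.
Qed.

Lemma integrable_le (R : realType) (d0 : measure_display)
    (T : measurableType d0) (P : probability T R) (X Y : T -> R) :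
  measurable_fun setT X -> (forall w, `|X w| <= Y w) ->
  P.-integrable setT (fun w => (Y w)%:E) -> P.-integrable setT (fun w => (X w)%:E).
Proof.
move=> mX XY; apply: le_integrable => //; first exact/measurable_EFinP.
by move=> w _; rewrite lee_fin (le_trans (XY w)) // ler_norm.
Qed.

(** The common shape of the dominating functions below; shorter ones are padded with zero
    coefficients. *)
Lemma integrable_lin (R : realType) (d0 : measure_display)
    (T : measurableType d0) (P : probability T R) (X Y : T -> R) (a b c : R) :
  P.-integrable setT (fun w => (X w)%:E) -> P.-integrable setT (fun w => (Y w)%:E) ->
  P.-integrable setT (fun w => (a * X w + b * Y w + c)%:E).
Proof.
move=> iX iY.
have i1 : P.-integrable setT (fun w => (a%:E * (X w)%:E)%E) by exact: integrableZl.
have i2 : P.-integrable setT (fun w => (b%:E * (Y w)%:E)%E) by exact: integrableZl.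
have i3 : P.-integrable setT (cst c%:E) by exact: finite_measure_integrable_cst.
exact: (integrableD measurableT (integrableD measurableT i1 i2) i3).
Qed.

Lemma integrable_sumr (R : realType) (d0 : measure_display)
    (T : measurableType d0) (P : probability T R) (I : finType) (X : I -> T -> R) :
  (forall i, P.-integrable setT (fun w => (X i w)%:E)) ->
  P.-integrable setT (fun w => (\sum_i X i w)%:E).
Proof.
move=> iX; under eq_fun do rewrite -sumEFin.
exact: integrable_sum.
Qed.

Lemma Rintegral_lin (R : realType) (d0 : measure_display)
    (T : measurableType d0) (P : probability T R) (X Y : T -> R) (a b c : R) :
  P.-integrable setT (fun w => (X w)%:E) -> P.-integrable setT (fun w => (Y w)%:E) ->
  Rintegral P setT (fun w => a * X w + b * Y w + c) =
  a * Rintegral P setT X + b * Rintegral P setT Y + c.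
Proof.
move=> iX iY.
have i1 : P.-integrable setT (EFin \o (fun w => a * X w)).
  exact: (integrableZl measurableT a iX).
have i2 : P.-integrable setT (EFin \o (fun w => b * Y w)).
  exact: (integrableZl measurableT b iY).
have i3 : P.-integrable setT (EFin \o (fun=> c)).
  exact: finite_measure_integrable_cst.
have i12 : P.-integrable setT (EFin \o (fun w => a * X w + b * Y w)).
  exact: (integrableD measurableT i1 i2).
rewrite (RintegralD measurableT i12 i3) (RintegralD measurableT i1 i2) !RintegralZl //.
rewrite Rintegral_cst // [X in fine X](_ : _ = 1%E) ?mulr1 //.
exact: probability_setT.
Qed.

Lemma measurable_gamma_factor (R : realType) (d0 : measure_display)
    (T : measurableType d0) (a s : T -> R) : (forall w, 0 <= s w) ->
  measurable_fun setT a -> measurable_fun setT s ->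
  measurable_fun setT (fun w => gamma_factor (a w) (s w)).
Proof.
move=> s0 ma ms.
(* The real power with exponent [-1] is measurable and agrees with the inverse on nonnegative
   numbers, including the value [0] at [0]. *)
have -> : (fun w => gamma_factor (a w) (s w)) =
    (fun w => a w ^+ 2 * (a w ^+ 2 + s w) `^ (-1)).
  by apply/funext => w; rewrite gamma_factorE powR_inv1 // addr_ge0 ?sqr_ge0.
have ma2 : measurable_fun setT (fun w => a w ^+ 2) by exact: measurable_funX.
apply: measurable_funM => //.
apply: (measurableT_comp (measurable_powR (-1))).
exact: measurable_funD.
Qed.

Lemma measurable_sub_sigma (R : realType) (d0 : measure_display)
    (T : measurableType d0) (G : set (set T)) (K : T -> R) :
  <<s G >> `<=` measurable ->
  measurable_fun setT (K : g_sigma_algebraType G -> R) -> measurable_fun setT K.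
Proof. by move=> sG mK _ B mB; apply: sG; exact: mK. Qed.

Lemma integrable_sqr (R : realType) (d0 : measure_display)
    (T : measurableType d0) (P : probability T R) (X : T -> R) :
  measurable_fun setT X -> P.-integrable setT (fun w => (X w ^+ 2)%:E) ->
  P.-integrable setT (fun w => (X w)%:E).
Proof.
move=> mX iX2; apply: (integrable_le (Y := fun w => 1 * X w ^+ 2 + 0 * X w ^+ 2 + 1)).
- by [].
- move=> w; rewrite mul0r mul1r addr0 -real_normK ?num_real //.
  by have := sqr_ge0 (`|X w| - 1 / 2); rewrite expr2; lra.
- exact: integrable_lin.
Qed.

(** Each summand of the noise is a bounded history-measurable function of [gamma], possibly times
    [a], multiplied by a variable of conditional mean zero: [u - a] or [(u - a) ^ 2 - s]. *)
Lemma noise_centered (R : realType) (d0 : measure_display)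
    (T : measurableType d0) (P : probability T R) (G : set (set T))
    (a s u : T -> R) :
  <<s G >> `<=` measurable ->
  measurable_fun setT (a : g_sigma_algebraType G -> R) ->
  measurable_fun setT (s : g_sigma_algebraType G -> R) -> (forall w, 0 <= s w) ->
  P.-integrable setT (fun w => (u w)%:E) ->
  P.-integrable setT (fun w => (a w ^+ 2)%:E) ->
  P.-integrable setT (fun w => (s w)%:E) ->
  (forall A, <<s G >> A ->
    (\int[P]_(w in A) (u w)%:E = \int[P]_(w in A) (a w)%:E)%E) ->
  (forall A, <<s G >> A ->
    (\int[P]_(w in A) ((u w - a w) ^+ 2)%:E = \int[P]_(w in A) (s w)%:E)%E) ->
  P.-integrable setT (fun w => (noise (a w) (s w) (u w))%:E) /\
  Rintegral P setT (fun w => noise (a w) (s w) (u w)) = 0.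
Proof.
move=> sG maG msG s0 iu ia2 is_ ua uas.
pose c w := gamma_factor (a w) (s w); pose e w := u w - a w.
have c01 w : 0 <= c w <= 1 by exact: gamma_factor_itv.
have mcG : measurable_fun setT (c : g_sigma_algebraType G -> R).
  exact: measurable_gamma_factor.
have ma := measurable_sub_sigma sG maG; have ms := measurable_sub_sigma sG msG.
have mc := measurable_sub_sigma sG mcG.
have mu' : measurable_fun setT u by apply/measurable_EFinP; exact: measurable_int iu.
have me : measurable_fun setT e by exact: measurable_funB.
have me2 : measurable_fun setT (fun w => e w ^+ 2) by exact: measurable_funX.
have ia := integrable_sqr ma ia2.
have GT : <<s G >> setT by exact: (@measurableT _ (g_sigma_algebraType G)).
(* The variance identity on the whole space gives [e ^ 2] the finite integral of [s]. *)
have ie2 : P.-integrable setT (fun w => (e w ^+ 2)%:E).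
  apply/integrableP; split; first exact/measurable_EFinP.
  under eq_integral do rewrite gee0_abs ?lee_fin ?sqr_ge0 //.
  by rewrite uas // integrable_lty.
have ie := integrable_sqr me ie2.
have ies : P.-integrable setT (fun w => (e w ^+ 2 - s w)%:E).
  by exact: (integrableB measurableT ie2 is_).
pose K1 w := (c w ^+ 2 - c w) * a w; pose K2 w := c w ^+ 2 / 2.
have mK1 : measurable_fun setT (K1 : g_sigma_algebraType G -> R).
  apply: measurable_funM => //; apply: measurable_funB => //.
  exact: measurable_funX.
have mK2 : measurable_fun setT (K2 : g_sigma_algebraType G -> R).
  by apply: measurable_funM => //; exact: measurable_funX.
have c2 w : 0 <= c w ^+ 2 <= c w.
  have /andP[? ?] := c01 w; rewrite sqr_ge0 /= expr2 ler_piMr //.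
have i1 : P.-integrable setT (fun w => (K1 w * e w)%:E).
  apply: (integrable_le (Y := fun w => 1 * a w ^+ 2 + 1 * e w ^+ 2 + 0)).
  - by apply: measurable_funM => //; exact: measurable_sub_sigma mK1.
  - move=> w; rewrite /K1 -mulrA normrM !mul1r addr0.
    apply: (@le_trans _ _ (1 * `|a w * e w|)).
      by apply: ler_wpM2r => //; have := c01 w; have := c2 w; rewrite ler_norml; lra.
    rewrite mul1r ler_norml; have := sqr_ge0 (a w - e w); have := sqr_ge0 (a w + e w).
    have := sqr_ge0 (a w); have := sqr_ge0 (e w).
    by rewrite !expr2; lra.
  - exact: integrable_lin.
have i2 : P.-integrable setT (fun w => (K2 w * (e w ^+ 2 - s w))%:E).
  apply: (integrable_le (Y := fun w => 1 * e w ^+ 2 + 1 * s w + 0)).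
  - apply: measurable_funM; first exact: measurable_sub_sigma mK2.
    exact: measurable_funB.
  - move=> w; rewrite /K2 normrM !mul1r addr0.
    apply: (@le_trans _ _ (1 * `|e w ^+ 2 - s w|)).
      by apply: ler_wpM2r => //; have := c01 w; have := c2 w; rewrite ler_norml; lra.
    by rewrite mul1r ler_norml; have := s0 w; have := sqr_ge0 (e w); lra.
  - exact: integrable_lin.
have z1 : (\int[P]_w (K1 w * e w)%:E = 0)%E.
  apply: (integral_mul_eq0 sG) => // A GA.
  by apply: integral_sub_eq0 => //; [exact: sG|exact: ua].
have z2 : (\int[P]_w (K2 w * (e w ^+ 2 - s w))%:E = 0)%E.
  apply: (integral_mul_eq0 sG) => // A GA.
  by apply: integral_sub_eq0 => //; [exact: sG|exact: uas].
have -> : (fun w => noise (a w) (s w) (u w)) =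
  (fun w => 1 * (K1 w * e w) + 1 * (K2 w * (e w ^+ 2 - s w)) + 0).
  by apply/funext => w; rewrite !mul1r addr0.
have -> : (fun w => (noise (a w) (s w) (u w))%:E) =
  (fun w => (1 * (K1 w * e w) + 1 * (K2 w * (e w ^+ 2 - s w)) + 0)%:E).
  by apply/funext => w; rewrite !mul1r addr0.
split; first exact: integrable_lin.
by rewrite Rintegral_lin // /Rintegral z1 z2 /= !mulr0 !addr0.
Qed.

(** * The one-step inequality in expectation *)

Lemma measurable_adapted_step (R : realType) (d : nat) (f : 'rV[R]_d -> R) (L : R)
    (d0 : measure_display) (T : measurableType d0) (x u : T -> 'rV[R]_d)
    (s : T -> 'I_d -> R) (i : 'I_d) :
  0 < L -> L_smooth L f -> (forall w i, 0 <= s w i) ->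
  (forall i, measurable_fun setT (fun w => x w 0 i)) ->
  (forall i, measurable_fun setT (fun w => u w 0 i)) ->
  (forall i, measurable_fun setT (fun w => s w i)) ->
  measurable_fun setT (fun w => adapted_step f L (x w) (u w) (s w) 0 i).
Proof.
move=> L0 fL s0 mx mu ms.
under eq_fun do rewrite !mxE.
apply: measurable_funB => //; apply: measurable_funM => //.
apply: measurable_funM => //; apply: measurable_gamma_factor => //.
have := measurable_continuous_rV (L_smooth_continuous_grad (i := i) L0 fL) mx.
by under eq_fun do rewrite mxE.
Qed.

(** The pathwise inequality is integrated and the noise drops out. Integrability passes from the gap
    to the squared gradient, then to the variances and the noise, and finally to the next gap. *)
Lemma expected_step (R : realType) (d : nat) (f : 'rV[R]_d -> R)
    (mu L fstar cv Mv : R) (d0 : measure_display) (T : measurableType d0)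
    (P : probability T R) (G : set (set T)) (x u : T -> 'rV[R]_d)
    (s : T -> 'I_d -> R) :
  0 < mu -> 0 < L -> strongly_convex mu f -> L_smooth L f ->
  (forall y, fstar <= f y) -> (exists y, f y = fstar) -> 0 <= cv ->
  <<s G >> `<=` measurable ->
  (forall i, measurable_fun setT ((fun w => x w 0 i) : g_sigma_algebraType G -> R)) ->
  (forall i, measurable_fun setT ((fun w => s w i) : g_sigma_algebraType G -> R)) ->
  (forall w i, 0 <= s w i) ->
  (forall i, P.-integrable setT (fun w => (u w 0 i)%:E)) ->
  (forall i A, <<s G >> A -> (\int[P]_(w in A) (u w 0 i)%:E =
     \int[P]_(w in A) (grad f (x w) 0 i)%:E)%E) ->
  (forall i A, <<s G >> A ->
    (\int[P]_(w in A) ((u w 0 i - grad f (x w) 0 i) ^+ 2)%:E =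
     \int[P]_(w in A) (s w i)%:E)%E) ->
  (forall w, \sum_i s w i <= cv * enorm (grad f (x w)) ^+ 2 + Mv) ->
  P.-integrable setT (fun w => (f (x w) - fstar)%:E) ->
  let x' := fun w => adapted_step f L (x w) (u w) (s w) in
  P.-integrable setT (fun w => (f (x' w) - fstar)%:E) /\
  forall l, 0 <= l -> l * (1 + cv) <= 1 ->
    Rintegral P setT (fun w => f (x' w) - fstar) <=
    (1 - mu / (2 * L) * l) * Rintegral P setT (fun w => f (x w) - fstar)
    + Mv / (2 * L) * l ^+ 2.
Proof.
move=> mu0 L0 fmu fL fmin fex cv0 sG mxG msG s0 iu ua uas sle iD x'.
have mgG i : measurable_fun setT
    ((fun w => grad f (x w) 0 i) : g_sigma_algebraType G -> R).
  exact: (@measurable_continuous_rV R d _ (g_sigma_algebraType G) x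
    _ (L_smooth_continuous_grad (i := i) L0 fL)).
have mx i := measurable_sub_sigma sG (mxG i).
have ms i := measurable_sub_sigma sG (msG i).
have mg i := measurable_sub_sigma sG (mgG i).
have mu' i : measurable_fun setT (fun w => u w 0 i).
  by apply/measurable_EFinP; exact: measurable_int (iu i).
have cf : continuous f by move=> y; apply: differentiable_continuous; have [] := fL.
have mD' : measurable_fun setT (fun w => f (x' w) - fstar).
  apply: measurable_funB => //; apply: measurable_continuous_rV => // i.
  exact: measurable_adapted_step.
have gD w : enorm (grad f (x w)) ^+ 2 <= 2 * L * (f (x w) - fstar).
  exact: grad_le_gap.
have ig2 i : P.-integrable setT (fun w => (grad f (x w) 0 i ^+ 2)%:E).
  apply: (integrable_le (Y := fun w => 2 * L * (f (x w) - fstar)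
    + 0 * (f (x w) - fstar) + 0)).
  - exact: measurable_funX.
  - move=> w; rewrite mul0r !addr0 ger0_norm ?sqr_ge0 //.
    apply: le_trans (gD w); rewrite enormE (bigD1 i) //= lerDl.
    by rewrite sumr_ge0 // => j _; rewrite sqr_ge0.
  - exact: integrable_lin.
have is_ i : P.-integrable setT (fun w => (s w i)%:E).
  apply: (integrable_le (Y := fun w => cv * (2 * L) * (f (x w) - fstar)
    + 0 * (f (x w) - fstar) + Mv)) => //.
  - move=> w; rewrite mul0r addr0 ger0_norm //.
    apply: (@le_trans _ _ (\sum_i s w i)).
      by rewrite (bigD1 i) //= lerDl sumr_ge0.
    by apply: le_trans (sle w) _; rewrite lerD2r -mulrA ler_wpM2l.
  - exact: integrable_lin.
pose N i w := noise (grad f (x w) 0 i) (s w i) (u w 0 i).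
have [iN N0] : (forall i, P.-integrable setT (fun w => (N i w)%:E)) /\
    forall i, Rintegral P setT (N i) = 0.
  by split=> i; have [] := noise_centered sG (mgG i) (msG i) (s0 ^~ i) (iu i)
    (ig2 i) (is_ i) (ua i) (uas i).
have iS : P.-integrable setT (fun w => (\sum_i N i w)%:E) by exact: integrable_sumr.
have S0 : Rintegral P setT (fun w => \sum_i N i w) = 0.
  rewrite /Rintegral; under eq_integral do rewrite -sumEFin.
  rewrite integral_sum // big1 // => i _; have := N0 i; rewrite /Rintegral => h.
  by rewrite -[LHS]fineK ?h // integrable_fin_num.
have step l : 0 <= l -> l * (1 + cv) <= 1 -> forall w, f (x' w) - fstar <=
    (1 - mu / (2 * L) * l) * (f (x w) - fstar) + L^-1 * (\sum_i N i w)
    + Mv / (2 * L) * l ^+ 2.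
  move=> l0 l1 w; rewrite addrAC.
  exact: (adapted_step_gap (u w) mu0 L0 fmu fL fex (s0 w) (sle w) l0 l1).
have iD' : P.-integrable setT (fun w => (f (x' w) - fstar)%:E).
  (* The admissible value [l = 0] already supplies an integrable bound of the nonnegative new
     gap. *)
  apply: (integrable_le (Y := fun w => (1 - mu / (2 * L) * 0) * (f (x w) - fstar)
    + L^-1 * (\sum_i N i w) + Mv / (2 * L) * 0 ^+ 2)) => //.
  - by move=> w; rewrite ger0_norm ?subr_ge0 //; apply: step; rewrite ?mul0r.
  - exact: integrable_lin.
split=> // l l0 l1.
have -> : (1 - mu / (2 * L) * l) * Rintegral P setT (fun w => f (x w) - fstar)
    + Mv / (2 * L) * l ^+ 2 = Rintegral P setT (fun w =>
    (1 - mu / (2 * L) * l) * (f (x w) - fstar) + L^-1 * (\sum_i N i w)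
    + Mv / (2 * L) * l ^+ 2).
  by rewrite Rintegral_lin // S0 mulr0 addr0.
apply: le_Rintegral => //; first exact: integrable_lin.
by move=> w _; exact: step.
Qed.

(** * Induction along the iterates and conclusion *)

Theorem theorem1 (R : realType) (d : nat) (f : 'rV[R]_d -> R)
  (mu L fstar : R) (theta0 : 'rV[R]_d)
  (d0 : measure_display) (T : measurableType d0) (P : probability T R)
  (g : nat -> T -> 'rV[R]_d) (sigma2 : nat -> T -> 'I_d -> R)
  (cv Mv : R) :
  0 < mu -> 0 < L ->
  strongly_convex mu f -> L_smooth L f ->
  (forall x, fstar <= f x) -> (exists x, f x = fstar) ->
  0 < cv -> 0 < Mv ->
  let theta := iterates f (L^-1) theta0 g sigma2 in
  (* g_t has integrable coordinates *)
  (forall t i, P.-integrable setT (fun w => (g t w 0 i)%:E)) ->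
  (* sigma2_t is measurable w.r.t. the history and nonnegative *)
  (forall t i (B : set R), measurable B ->
      history theta t ((fun w => sigma2 t w i) @^-1` B)) ->
  (forall t w i, 0 <= sigma2 t w i) ->
  (* E[g_t | theta_0..theta_t] = grad f (theta_t) *)
  (forall t i A, history theta t A ->
      (\int[P]_(w in A) (g t w 0 i)%:E =
       \int[P]_(w in A) (grad f (theta t w) 0 i)%:E)%E) ->
  (* var[g_{t,i} | theta_0..theta_t] = sigma2_{t,i} *)
  (forall t i A, history theta t A ->
      (\int[P]_(w in A) ((g t w 0 i - grad f (theta t w) 0 i) ^+ 2)%:E =
       \int[P]_(w in A) (sigma2 t w i)%:E)%E) ->
  (* variance bound *)
  (forall t w, \sum_i sigma2 t w i <=
                cv * enorm (grad f (theta t w)) ^+ 2 + Mv) ->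
  (* E[f(theta_t) - f_*] = O(1/t) *)
  exists (C : R) (N : nat), forall t : nat, (N <= t)%N ->
    (\int[P]_w (f (theta t w) - fstar)%:E <= (C / t%:R)%:E)%E.
Proof.
move=> mu0 L0 fmu fL fmin fex cv0 Mv0 theta ig msG s0 ga gvar sle.
(* These sets generate [history theta t], which is convertible with [<<s G t>>]. *)
pose G t := [set A | exists (s : nat) (i : 'I_d) (B : set R),
  (s <= t)%N /\ measurable B /\ A = (fun w => theta s w 0 i) @^-1` B].
have sG t : (forall r i, (r <= t)%N -> measurable_fun setT (fun w => theta r w 0 i)) ->
    <<s G t >> `<=` measurable.
  move=> mtheta; apply: smallest_sub; first exact: sigma_algebra_measurable.
  move=> _ [r [i [B [rt [mB ->]]]]]; rewrite -[X in measurable X]setTI.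
  exact: mtheta.
have mthetaG t i : measurable_fun setT
    ((fun w => theta t w 0 i) : g_sigma_algebraType (G t) -> R).
  by move=> _ B mB; rewrite setTI; apply: sub_sigma_algebra; exists t, i, B.
have msG' t i : measurable_fun setT
    ((fun w => sigma2 t w i) : g_sigma_algebraType (G t) -> R).
  by move=> _ B mB; rewrite setTI; exact: msG.
(* Strong induction is used: measurability of [sigma2 t] comes from the history, which consists of
   measurable sets once all iterates up to [t] are measurable. *)
have mtheta t i : measurable_fun setT (fun w => theta t w 0 i).
  elim/ltn_ind: t i => -[|t] IH i; first exact: measurable_cst.
  have sGt : <<s G t >> `<=` measurable by apply: sG => r j rt; exact: IH.
  apply: (measurable_adapted_step (x := theta t) (u := g t) (s := sigma2 t)) => // j.
  - exact: IH.
  - by apply/measurable_EFinP; exact: measurable_int (ig t j).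
  - exact: measurable_sub_sigma sGt (msG' t j).
have step t := @expected_step R d f mu L fstar cv Mv d0 T P (G t) (theta t) (g t)
  (sigma2 t) mu0 L0 fmu fL fmin fex (ltW cv0) (sG t (fun r i _ => mtheta r i))
  (mthetaG t) (msG' t) (s0 t) (ig t) (ga t) (gvar t) (sle t).
have iD t : P.-integrable setT (fun w => (f (theta t w) - fstar)%:E).
  elim: t => [|t IH]; last by have [] := step t IH.
  exact: (finite_measure_integrable_cst P (f theta0 - fstar)).
pose e t := Rintegral P setT (fun w => f (theta t w) - fstar).
(* The threshold [1 / (1 + cv)] is the constraint [l * (1 + cv) <= 1] of the one-step inequality. *)
have [||||t l l0 l1|C eC] := @le_inv_of_recursion R e (mu / (2 * L)) (Mv / (2 * L))
    (1 + cv)^-1.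
- by rewrite divr_gt0 // mulr_gt0.
- by rewrite divr_ge0 ?(ltW Mv0) // mulr_ge0 // ltW.
- by rewrite invr_gt0 ltr_wpDl.
- by apply: Rintegral_ge0 => w _; rewrite subr_ge0.
- have [_] := step t (iD t); apply=> //.
  by rewrite -ler_pdivlMr ?div1r // ltr_wpDl.
exists C, 1%N => t t0; have := eC t t0; rewrite -lee_fin /e /Rintegral fineK //.
exact: integrable_fin_num.
Qed.
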